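(* Let $p$ be an odd prime and let $G$ be a group with $|G|=p^n$ and $|Z(G)|=p^{n-2}$. Then the independence number of the commuting graph $\zeta(G,G)$ is $p+1$.
   Context: $Z(G)$ is the center of $G$. The commuting graph $\zeta(G,G)$ is the simple graph with vertex set $G$ in which two distinct vertices are adjacent if and only if they commute in $G$. The independence number is the number of vertices in a maximum independent set (a set of pairwise non-adjacent vertices). *)

(* Defs.v *)
From HB Require Import structures.
From mathcomp Require Import all_boot all_fingroup all_solvable.

Set Implicit Arguments.
Unset Strict Implicit.
Unset Printing Implicit Defensive.

Record sgraph := SGraph {
  vertex : finType;
  adj : rel vertex;
  adj_sym : symmetric adj;
  adj_irr : irreflexive adj
}.

Definition independent (Gr : sgraph) (S : {set vertex Gr}) : bool :=
  [forall x in S, forall y in S, ~~ adj x y].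

Definition independence_number (Gr : sgraph) : nat :=
  \max_(S : {set vertex Gr} | independent S) #|S|.

Definition commuting_adj (gT : finGroupType) (G : {group gT}) :
    rel (subg_of G) :=
  fun x y => (x != y) && (x * y == y * x)%g.

Lemma commuting_adj_sym (gT : finGroupType) (G : {group gT}) :
  symmetric (@commuting_adj gT G).
Proof.
by move=> x y; rewrite /commuting_adj eq_sym; congr (_ && _); rewrite eq_sym.
Qed.

Lemma commuting_adj_irr (gT : finGroupType) (G : {group gT}) :
  irreflexive (@commuting_adj gT G).
Proof. by move=> x; rewrite /commuting_adj eqxx. Qed.

Definition commuting_graph (gT : finGroupType) (G : {group gT}) : sgraph :=
  SGraph (@commuting_adj_sym gT G) (@commuting_adj_irr gT G).

(* Main.v *)
Require Import Defs.
From mathcomp Require Import all_boot all_fingroup all_solvable.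

(** For a noncentral [x], the orders [|Z(G)| = p ^ (n - 2)] and [|G| = p ^ n] force
    both ['C_G[x]] and its center, which contains [x] and [Z(G)], to have order
    [p ^ (n - 1)]; so ['C_G[x]] is abelian.  Hence commuting is an equivalence
    relation on the noncentral elements, with classes ['C_G[x] :\: 'Z(G)] of size
    [p ^ (n - 1) - p ^ (n - 2)], and there are [p + 1] of them.  Maximum
    independent sets are the transversals of this partition. *)

Set Implicit Arguments.
Unset Strict Implicit.
Unset Printing Implicit Defensive.

Section CenterOfIndexPSquared.

Local Open Scope group_scope.

(** By Lagrange [#|H|] is some [p ^ k], and the two strict bounds leave only [k = m.+1]. *)
Lemma card_group_between_ppow (p m : nat) (gT : finGroupType)
    (K H : {group gT}) :
  prime p -> #|K| = (p ^ m.+2)%N -> H \proper K -> p ^ m < #|H| ->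
  #|H| = (p ^ m.+1)%N.
Proof.
move=> p_pr cardK /andP[sHK nsKH] ltH.
have p_gt1 := prime_gt1 p_pr.
have /(dvdn_pfactor _ _ p_pr)[k _ cardH] : #|H| %| p ^ m.+2.
  by rewrite -cardK cardSg.
have ltHK : #|H| < #|K| by rewrite proper_card // properE sHK.
move: ltH ltHK; rewrite cardH cardK !ltn_exp2l // => lt_mk lt_km.
by congr (_ ^ _)%N; apply/eqP; rewrite eqn_leq lt_mk -ltnS lt_km.
Qed.

(** ['Z(G)] lies in every centralizer, so it is removed to make distinct blocks disjoint. *)
Definition noncentral_centralizers (gT : finGroupType) (G : {group gT}) :
    {set {set gT}} :=
  [set 'C_G[x] :\: 'Z(G) | x in G :\: 'Z(G)].

Variables (p m : nat) (gT : finGroupType) (G : {group gT}).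
Hypotheses (p_pr : prime p) (cardG : #|G| = (p ^ m.+2)%N).
Hypothesis cardZ : #|'Z(G)| = (p ^ m)%N.

Lemma center_proper_cent1 x : x \in G :\: 'Z(G) -> 'Z(G) \proper 'C_G[x].
Proof.
case/setDP=> Gx nZx; rewrite properE; apply/andP; split.
  rewrite subsetI center_sub (subset_trans (subsetIr G 'C(G))) //.
  by rewrite -cent_set1 centS // sub1set.
by apply: contra nZx => /subsetP; apply; rewrite inE Gx cent1id.
Qed.

Lemma card_cent1_noncentral x :
  x \in G :\: 'Z(G) -> #|'C_G[x]| = (p ^ m.+1)%N.
Proof.
move=> ncx; apply: (card_group_between_ppow p_pr cardG) => /=.
  rewrite properE subsetIl /=; case/setDP: ncx => Gx.
  apply: contra => sGC; rewrite inE Gx -sub_cent1.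
  exact: subset_trans sGC (subsetIr _ _).
by rewrite -cardZ proper_card // center_proper_cent1.
Qed.

Lemma abelian_cent1_noncentral x : x \in G :\: 'Z(G) -> abelian 'C_G[x].
Proof.
move=> ncx; have [Gx nZx] := setDP ncx.
have sZC := proper_sub (center_proper_cent1 ncx).
have sZZ : 'Z(G) \subset 'Z('C_G[x]).
  rewrite subsetI sZC (subset_trans (subsetIr _ _)) //.
  by rewrite centS ?subsetIl.
have Zx : x \in 'Z('C_G[x]).
  by rewrite inE inE Gx cent1id -sub_cent1 subsetIr.
have ltZ : p ^ m < #|'Z('C_G[x])|.
  rewrite -cardZ proper_card // properE sZZ.
  by apply: contra nZx => /subsetP; apply.
have cardZC : #|'Z('C_G[x])| = (p ^ m.+1)%N.
  (* The ambient group is [G], of order [p ^ m.+2], rather than ['C_G[x]]; properness in [G] follows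
     by comparing orders. *)
  apply: (card_group_between_ppow p_pr cardG) => //=.
  have sZG : 'Z('C_G[x]) \subset G.
    exact: subset_trans (center_sub _) (subsetIl _ _).
  rewrite properEcard sZG; apply: leq_ltn_trans (subset_leq_card (center_sub _)) _.
  by rewrite card_cent1_noncentral // cardG ltn_exp2l // prime_gt1.
apply/center_idP/eqP.
by rewrite eqEcard center_sub cardZC card_cent1_noncentral /=.
Qed.

(** This gives transitivity of commuting on noncentral elements. As ['C_G[x]] is abelian and
    contains [y], it centralizes [y]; equal orders turn this inclusion into equality. *)
Lemma cent1_noncentral_eq x y :
    x \in G :\: 'Z(G) -> y \in G :\: 'Z(G) -> y \in 'C_G[x] ->
  'C_G[x] = 'C_G[y].
Proof.
move=> ncx ncy Cxy; apply/eqP.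
rewrite eqEcard !card_cent1_noncentral // leqnn andbT.
rewrite subsetI subsetIl sub_cent1.
exact: subsetP (abelian_cent1_noncentral ncx) _ Cxy.
Qed.

Lemma mem_cent1_noncentral x :
  x \in G :\: 'Z(G) -> x \in 'C_G[x] :\: 'Z(G).
Proof. by case/setDP=> Gx nZx; rewrite in_setD nZx in_setI Gx cent1id. Qed.

Lemma noncentral_centralizers_partition :
  partition (noncentral_centralizers G) (G :\: 'Z(G)).
Proof.
apply/and3P; split.
- rewrite eqEsubset; apply/andP; split.
    apply/bigcupsP=> _ /imsetP[x _ ->].
    by rewrite setSD ?subsetIl.
  apply/subsetP=> x ncx; apply/bigcupP; exists ('C_G[x] :\: 'Z(G)).
    exact: imset_f.
  exact: mem_cent1_noncentral.
- apply/trivIsetP=> _ _ /imsetP[x ncx ->] /imsetP[y ncy ->].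
  apply: contraR; rewrite -setI_eq0 => /set0Pn[z].
  case/setIP=> /setDP[Cxz nZz] /setDP[Cyz _].
  (* A common element [z] of two blocks is noncentral, so both centralizers equal ['C_G[z]]. *)
  have ncz : z \in G :\: 'Z(G).
    by rewrite inE nZz; case/setIP: Cxz.
  by rewrite (cent1_noncentral_eq ncx ncz) // (cent1_noncentral_eq ncy ncz).
- apply/imsetP=> -[x /mem_cent1_noncentral + eq0].
  by rewrite -eq0 inE.
Qed.

Lemma card_noncentral_centralizers : #|noncentral_centralizers G| = p.+1.
Proof.
have p_gt1 := prime_gt1 p_pr.
have /card_uniform_partition/(_ noncentral_centralizers_partition) :
    {in noncentral_centralizers G, forall A : {set gT},
       #|A| = p ^ m.+1 - p ^ m}%N.
  move=> _ /imsetP[x ncx ->].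
  rewrite cardsDS; last exact: proper_sub (center_proper_cent1 ncx).
  by rewrite card_cent1_noncentral // cardZ.
rewrite cardsDS ?center_sub // cardG cardZ.
(* Both sides are [p ^ m * (p - 1) * (p + 1)]; the positive block size then cancels. *)
have -> : (p ^ m.+2 - p ^ m = p.+1 * (p ^ m.+1 - p ^ m))%N.
  by rewrite mulnBr !mulSn -!expnS [(p ^ m + _)%N]addnC subnDl.
move/eqP; rewrite eqn_pmul2r; first by move/eqP.
by rewrite subn_gt0 ltn_exp2l.
Qed.

Lemma independent_commuting_leq (S : {set subg_of G}) :
  @independent (commuting_graph G) S -> #|S| <= p.+1.
Proof.
move=> indS.
(* Adjacency requires distinct vertices, so commuting members of [S] must coincide. *)
have indepE x y : x \in S -> y \in S -> commute (sgval x) (sgval y) -> x = y.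
  move=> Sx Sy cxy; apply/eqP.
  have /forall_inP/(_ x Sx)/forall_inP/(_ y Sy) := indS.
  rewrite /= /commuting_adj negb_and negbK => /orP[//|/eqP[]].
  exact: val_inj.
(* A central member commutes with all of [S], which is then a singleton. *)
have [/existsP[z /andP[Sz Zz]] | noZ] :=
    boolP [exists z, (z \in S) && (sgval z \in 'Z(G))].
  suff /subset_leq_card : S \subset [set z].
    by rewrite cards1 => /leq_trans; apply.
  apply/subsetP=> x Sx; rewrite inE; apply/eqP/indepE => //.
  by apply/commute_sym/(centP (subsetP (subsetIr _ _) _ Zz)); apply: subgP.
have ncS x : x \in S -> sgval x \in G :\: 'Z(G).
  move=> Sx; rewrite inE subgP andbT; apply: contra noZ => Zx.
  by apply/existsP; exists x; rewrite Sx.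
rewrite -card_noncentral_centralizers.
(* With no central member, [S] injects into the blocks: members with the same block commute. *)
rewrite -(card_in_imset (f := fun x => 'C_G[sgval x] :\: 'Z(G))).
  apply/subset_leq_card/subsetP=> _ /imsetP[x Sx ->].
  exact/imset_f/ncS.
move=> x y Sx Sy eqC; apply: indepE => //.
have := mem_cent1_noncentral (ncS x Sx).
by rewrite eqC => /setDP[/setIP[_ /cent1P]].
Qed.

Lemma exists_independent_commuting :
  exists2 S : {set subg_of G},
    @independent (commuting_graph G) S & #|S| = p.+1.
Proof.
set D := G :\: 'Z(G); set P := noncentral_centralizers G.
have partP : partition P D := noncentral_centralizers_partition.
have trX := transversalP partP; set X := transversal P D in trX.
have sXD : X \subset D := transversal_sub trX.
have XG x : x \in X -> x \in G by move/(subsetP sXD)/setDP=> [].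
(* Vertices live in [subg_of G], so the transversal is lifted by [subg G], which is injective on
   [G]. *)
exists (subg G @: X).
  apply/forall_inP=> _ /imsetP[x Xx ->].
  apply/forall_inP=> _ /imsetP[y Xy ->].
  rewrite /= /commuting_adj negb_and negbK orbC -implybE.
  apply/implyP=> /eqP/(congr1 val) /=.
  rewrite !subgK ?XG // => cxy; apply/eqP; congr (subg G _).
  have [Dx Dy] := (subsetP sXD _ Xx, subsetP sXD _ Xy).
  have PC : 'C_G[x] :\: 'Z(G) \in P by apply: imset_f.
  have [_ tiP _] := and3P partP.
  (* Commuting [x] and [y] both lie in the block of [x], which meets [X] only once. *)
  apply: (pblock_inj trX) => //.
  rewrite (def_pblock tiP PC (mem_cent1_noncentral Dx)).
  rewrite (def_pblock tiP PC) //.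
  rewrite inE; case/setDP: Dy => Gy -> /=.
  by rewrite inE Gy; apply/cent1P.
rewrite card_in_imset; last first.
  by move=> x y Xx Xy /(congr1 val) /=; rewrite !subgK ?XG.
by rewrite (card_transversal trX) card_noncentral_centralizers.
Qed.

End CenterOfIndexPSquared.

Theorem theorem4p3 (p n : nat) (gT : finGroupType) (G : {group gT})
  (p_prime : prime p) (p_odd : odd p) (n_ge2 : 2 <= n)
  (cardG : #|G| = p ^ n) (cardZ : #|'Z(G)%g| = p ^ (n - 2)) :
  independence_number (commuting_graph G) = p + 1.
Proof.
case: n n_ge2 cardG cardZ => [|[|m]] // _ cardG; rewrite !subSS subn0 => cardZ.
rewrite addn1; apply/eqP; rewrite eqn_leq; apply/andP; split.
  by apply/bigmax_leqP=> S; apply: independent_commuting_leq cardZ S.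
have [S indS <-] := exists_independent_commuting p_prime cardG cardZ.
exact: (leq_bigmax_cond (F := fun S : {set vertex (commuting_graph G)} => #|S|)).
Qed.
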